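(* Let $A$ be a non-zero positive bounded operator on a complex Hilbert space $\mathscr{H}$ and let $B,C\in\mathbb{B}_A(\mathscr{H})$. Then $$\max\big\{w_A^2(B)+c_A^2(C),\ w_A^2(C)+c_A^2(B)\big\}\le w_{A,e}^2(B,C).$$
   Context: $\mathbb{B}(\mathscr{H})$ is the algebra of bounded linear operators on $\mathscr{H}$. For $x,y\in\mathscr{H}$, $\langle x,y\rangle_A=\langle Ax,y\rangle$ and $\|x\|_A=\langle Ax,x\rangle^{1/2}$. $\mathbb{B}_A(\mathscr{H})$ is the set of $T\in\mathbb{B}(\mathscr{H})$ for which there is $S\in\mathbb{B}(\mathscr{H})$ with $AS=T^*A$. The $A$-numerical radius and $A$-Crawford number are $w_A(T)=\sup\{|\langle Tx,x\rangle_A|:\|x\|_A=1\}$ and $c_A(T)=\inf\{|\langle Tx,x\rangle_A|:\|x\|_A=1\}$. The $A$-Euclidean operator radius of a pair is $w_{A,e}(B,C)=\sup\{(|\langle Bx,x\rangle_A|^2+|\langle Cx,x\rangle_A|^2)^{1/2}: \|x\|_A=1\}$. Superscript $2$ on $w_A$, $c_A$ and $w_{A,e}$ denotes the square of the value. *)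

(* Defs.v *)
From HB Require Import structures.
From mathcomp Require Import all_boot all_order all_algebra sesquilinear.
From mathcomp Require Import complex.
From mathcomp Require Import boolp classical_sets reals topology normedtype.

Set Implicit Arguments.
Unset Strict Implicit.
Unset Printing Implicit Defensive.

Import Order.TTheory GRing.Theory Num.Theory.
Import numFieldNormedType.Exports.

Local Open Scope classical_set_scope.
Local Open Scope complex_scope.
Local Open Scope ring_scope.

(* A complex Hilbert space is a complete normed module [H] over [R[i]] whose
   norm is induced by an inner product [ip]; as a [{dot H for Num.conj}], [ip]
   is linear in its first argument, conjugate-linear in the second, hermitian
   and positive definite. *)
Definition hilbert (R : realType) (H : completeNormedModType R[i])
    (ip : {dot H for Num.conj}) : Prop :=
  forall x : H, `|x| ^+ 2 = ip x x.

Definition bounded_op (R : realType) (H : completeNormedModType R[i])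
    (T : {linear H -> H}) : Prop :=
  bounded_near T (nbhs (0 : H)).

Section SemiHilbert.
Variables (R : realType) (H : completeNormedModType R[i]).
Variable ip : {dot H for Num.conj}.

(* The order of [R[i]] makes [0 <= z] mean that [z] is real and nonnegative;
   on a complex space this entails self-adjointness. *)
Definition positive_op (A : {linear H -> H}) : Prop :=
  forall x : H, 0 <= ip (A x) x.

Definition is_adjoint (T Tstar : {linear H -> H}) : Prop :=
  forall x y : H, ip (T x) y = ip x (Tstar y).

Variable A : {linear H -> H}.

Definition ipA (x y : H) : R[i] := ip (A x) y.

(* For positive [A], [ipA x x] is a nonnegative real number. *)
Definition normA (x : H) : R := Num.sqrt (complex.Re (ipA x x)).

(* [T] is a bounded operator and [A S = T^* A] for some bounded [S]; the
   operator [T^*] is given by the property that characterizes it. *)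
Definition in_BA (T : {linear H -> H}) : Prop :=
  bounded_op T /\
  exists S Tstar : {linear H -> H},
    [/\ bounded_op S, bounded_op Tstar, is_adjoint T Tstar &
        forall x : H, A (S x) = Tstar (A x)].

Definition modA (T : {linear H -> H}) (x : H) : R :=
  ComplexField.Normc.normc (ipA (T x) x).

(* The suprema below are taken in [R], where [sup] and [inf] are meaningful
   only for nonempty sets bounded above, resp. below.  This holds here: the
   [A]-unit sphere is nonempty when [A] is positive and nonzero, and an
   operator [T] with [in_BA T] satisfies [normA (T x) <= c * normA x]. *)
Definition wA (T : {linear H -> H}) : R :=
  sup [set modA T x | x in [set x : H | normA x = 1]].

Definition cA (T : {linear H -> H}) : R :=
  inf [set modA T x | x in [set x : H | normA x = 1]].

Definition wAe (B C : {linear H -> H}) : R :=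
  sup [set Num.sqrt (modA B x ^+ 2 + modA C x ^+ 2)
        | x in [set x : H | normA x = 1]].

End SemiHilbert.

(* Main.v *)
(* For an A-unit vector x one has |<Bx,x>_A|^2 + c_A(C)^2 <= w_{A,e}(B,C)^2,
   and the inequality follows by taking the supremum over x.  Since [sup] is
   only meaningful on nonempty bounded sets, the substance lies in two facts:
   the A-unit sphere is nonempty, by polarization, and <Tx,x>_A is bounded on
   it for T in B_A(H).  For the latter, with A S = T^* A the operator P = S T
   is A-selfadjoint and |<Tx,x>_A|^2 <= <Tx,Tx>_A = <Px,x>_A; iterating
   Cauchy-Schwarz on the powers of P shows that <Px,x>_A <= ||P||. *)
Require Import Defs.
From mathcomp Require Import all_boot all_order all_algebra sesquilinear.
From mathcomp Require Import complex ring.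
From mathcomp Require Import boolp classical_sets reals topology normedtype.
Import Order.TTheory GRing.Theory Num.Theory.
Import numFieldNormedType.Exports.
Local Open Scope ring_scope.

(** Otherwise [a / k = 1 + e] with [e > 0], and by Bernoulli the powers [(1 + e) ^+ (2 ^ n)] outgrow
    [M]. *)
Lemma le_of_expr2n_le (R : realType) (a k M : R) : 0 <= a -> 0 < k ->
  (forall m, a ^+ (2 ^ m) <= M * k ^+ (2 ^ m)) -> a <= k.
Proof.
move=> a0 k0 le_aM; rewrite leNgt; apply/negP => lt_ka.
have [e e0 aE] : exists2 e, 0 < e & a = (1 + e) * k.
  exists (a / k - 1); first by rewrite subr_gt0 ltr_pdivlMr ?mul1r.
  by rewrite addrC subrK divfK ?gt_eqF.
have bern n : 1 + e *+ n <= (1 + e) ^+ n.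
  elim: n => [|n IHn]; first by rewrite mulr0n addr0 expr0.
  rewrite exprS (le_trans _ (ler_wpM2l _ IHn)) ?addr_ge0 ?(ltW e0) //.
  rewrite mulrDr mulr1 mulrDl mul1r mulrS !addrA lerDl.
  by rewrite mulr_ge0 ?mulrn_wge0 ?(ltW e0).
have leM n : (1 + e) ^+ (2 ^ n) <= M.
  by rewrite -(ler_pM2r (exprn_gt0 (2 ^ n) k0)) -exprMn -aE.
(* This [N] gives [M < e * N], and [N < 2 ^ N] carries the bound to the exponent where Bernoulli is
   applied. *)
pose N := (Num.truncn (M / e)).+1.
have : M < e *+ (2 ^ N).
  rewrite (@lt_le_trans _ _ (e *+ N)) //.
    by rewrite -mulr_natl -ltr_pdivrMr // truncnS_gt.
  by rewrite ler_wpMn2l ?(ltW e0) // ltnW // ltn_expl.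
rewrite ltNge (le_trans _ (leM N)) // (le_trans _ (bern _)) //.
by rewrite lerDr.
Qed.

Lemma bounded_op_bound (R : realType) (H : completeNormedModType (complex R))
    (T : {linear H -> H}) : bounded_op T ->
  exists2 k : R, 0 < k & forall x, `|T x| <= real_complex R k * `|x|.
Proof.
move=> /linear_boundedP [r [r_real Tr]].
have /complex_realP [s rE] := r_real.
(* Every constant strictly above [s] is a bound; this one is also positive. *)
exists (Num.max s 0 + 1); first by rewrite ltr_pwDr // le_max lexx orbT.
apply: Tr; rewrite rE ltcR.
by rewrite (@le_lt_trans _ _ (Num.max s 0)) ?le_max ?lexx // ltrDl.
Qed.

Section SemiInnerProduct.
Variables (R : realType) (H : completeNormedModType (complex R)).
Variables (ip : {dot H for Num.conj}) (A : {linear H -> H}).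
Local Notation f := (ipA ip A).

Lemma ipADl x y z : f (x + y) z = f x z + f y z.
Proof. by rewrite /ipA linearD linearDl. Qed.

Lemma ipADr x y z : f x (y + z) = f x y + f x z.
Proof. by rewrite /ipA linearDr. Qed.

Lemma ipAZl c x y : f (c *: x) y = c * f x y.
Proof. by rewrite /ipA linearZ linearZl_LR. Qed.

Lemma ipAZr c x y : f x (c *: y) = Num.conj c * f x y.
Proof. by rewrite /ipA linearZr_LR. Qed.

Lemma modA_ge0 (T : {linear H -> H}) x : 0 <= modA ip A T x.
Proof. by rewrite /modA; case: (f _ _) => a b; apply: sqrtr_ge0. Qed.

Lemma ip_conj x y : ip x y = Num.conj (ip y x).
Proof. by rewrite hermC expr0 mul1r. Qed.

(** Polarization: with its companion for [x + 'i *: y], this recovers the form from its diagonal. *)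
Lemma ipA_crossD x y : f (x + y) (x + y) - f x x - f y y = f x y + f y x.
Proof. by rewrite ipADl !ipADr; ring. Qed.

Lemma ipA_crossDi x y :
  f (x + 'i *: y) (x + 'i *: y) - f x x - f y y = 'i * (f y x - f x y).
Proof.
have ii : 'i * 'i = -1 :> complex R by rewrite -expr2 sqrCi.
by rewrite ipADl !ipADr !ipAZl !ipAZr conjCi; ring: ii.
Qed.

(** Polarization at [x] and [A x] gives [f x (A x) = 0], and this value is [ip (A x) (A x)]. *)
Lemma ipA_eq0 : (forall x, f x x = 0) -> forall x, A x = 0.
Proof.
move=> f0 x; have := ipA_crossD x (A x); have := ipA_crossDi x (A x).
rewrite !f0 !subr0 => /esym/eqP; rewrite mulf_eq0 (negPf (neq0Ci _)) subr_eq0 /= => /eqP ->.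
move/esym/eqP; rewrite -mulr2n mulrn_eq0 /= /ipA.
by rewrite dnorm_eq0 => /eqP.
Qed.

Hypothesis A_pos : positive_op ip A.

(** Positivity makes the diagonal real, so conjugation fixes the left sides of both polarization
    identities. *)
Lemma ipA_conj x y : f x y = Num.conj (f y x).
Proof.
have fJ z : Num.conj (f z z) = f z z by apply/CrealP/ger0_real/A_pos.
have := congr1 Num.conj (ipA_crossD x y).
have := congr1 Num.conj (ipA_crossDi x y).
rewrite !(rmorphB, rmorphM, rmorphD) /= !fJ ipA_crossD ipA_crossDi conjCi.
rewrite mulNr -mulrN => /(mulfI (neq0Ci _)) E1 E2.
apply: (@mulfI _ 2); first by rewrite pnatr_eq0.
have -> : 2 * f x y = f x y + f y x - (f y x - f x y) by ring.
by rewrite E1 E2; ring.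
Qed.

Lemma ipA_unit x : normA ip A x = 1 -> f x x = 1.
Proof.
have := A_pos x; rewrite -/(f x x) /normA; case: (f x x) => a b.
rewrite lecE /= => /andP[/eqP -> a_ge0] a1.
by rewrite -[a]sqr_sqrtr // a1 expr1n.
Qed.

(** Cauchy-Schwarz against an [A]-unit vector: the gap is the form at [u] minus its [A]-projection
    on [x]. *)
Lemma normr_ipA_le u x : f x x = 1 -> `|f u x| ^+ 2 <= f u u.
Proof.
move=> x1; rewrite -subr_ge0.
suff -> : f u u - `|f u x| ^+ 2 = f (u - f u x *: x) (u - f u x *: x).
  exact: A_pos.
rewrite -scaleNr ipADl !ipADr !ipAZl !ipAZr x1 rmorphN (ipA_conj x u) normCK.
by ring.
Qed.

Hypothesis ip_norm : hilbert ip.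

Lemma ip_double_le u v : ip u v + ip v u <= `|u| ^+ 2 + `|v| ^+ 2.
Proof.
rewrite !ip_norm -subr_ge0.
suff -> : ip u u + ip v v - (ip u v + ip v u) = ip (u - v) (u - v).
  by rewrite -ip_norm exprn_ge0.
by rewrite linearBl !linearBr; ring.
Qed.

Hypothesis A_bounded : bounded_op A.

Lemma ipA_bound : exists c : R, forall u, f u u <= real_complex R c * `|u| ^+ 2.
Proof.
have [k k_gt0 Ak] := bounded_op_bound _ _ _ A_bounded.
(* The constant comes from [2 <Au,u> <= |Au|^2 + |u|^2], where [<Au,u>] is real and nonnegative. *)
exists (k ^+ 2 + 1) => u.
have -> : real_complex R (k ^+ 2 + 1) * `|u| ^+ 2
    = (real_complex R k * `|u|) ^+ 2 + `|u| ^+ 2.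
  by rewrite rmorphD rmorphXn rmorph1; ring.
have := ip_double_le (A u) u; rewrite (ip_conj u (A u)) (conj_Creal (ger0_real (A_pos u))).
rewrite -mulr2n => le2; apply: (@le_trans _ _ (f u u *+ 2)).
  by rewrite mulr2n lerDl A_pos.
apply: (le_trans le2); rewrite lerD2r lerXn2r ?nnegrE ?normr_ge0 //.
by rewrite mulr_ge0 // ler0c ltW.
Qed.

(* For an [A]-selfadjoint [P] and an [A]-unit vector [x], Cauchy-Schwarz gives
   [<P^m x, x>_A ^ 2 <= <P^(2m) x, x>_A], so that the [2^n]-th power of
   [<P x, x>_A] grows at most like [||P|| ^ (2^n)]. *)
Lemma ipA_selfadjoint_le (P : {linear H -> H}) (k : R) x : 0 < k ->
    (forall y, `|P y| <= real_complex R k * `|y|) ->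
    (forall y z, f (P y) z = f y (P z)) ->
    (0 <= f (P x) x) ->
  f x x = 1 -> f (P x) x <= real_complex R k.
Proof.
move=> k_gt0 Pk Psym Px_ge0 x1.
have Pm_sym m y z : f (iter m P y) z = f y (iter m P z).
  by elim: m y z => //= m IHm y z; rewrite Psym IHm -iterSr.
have Pm_le m : `|iter m P x| <= real_complex R (k ^+ m) * `|x|.
  elim: m => [|m IHm]; first by rewrite expr0 mul1r.
  rewrite (le_trans (Pk _)) // exprS rmorphM -mulrA ler_wpM2l //.
  by rewrite ler0c ltW.
have pow n : f (P x) x ^+ (2 ^ n) <= f (iter (2 ^ n) P x) x.
  elim: n => [|n IHn]; first by rewrite expr1.
  have it_ge0 : 0 <= f (iter (2 ^ n) P x) x.
    by apply: (le_trans _ IHn); apply: exprn_ge0.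
  rewrite expnSr exprM (le_trans (lerXn2r 2 _ _ IHn)) ?nnegrE ?exprn_ge0 //.
  rewrite -(ger0_norm it_ge0) (le_trans (normr_ipA_le _ _ x1)) //.
  by rewrite muln2 -addnn iterD [leRHS]Pm_sym.
have [c fc] := ipA_bound.
have /complex_realP[a aE] := ger0_real Px_ge0.
have /complex_realP[r rE] := normr_real x.
rewrite aE lecR; rewrite aE ler0c in Px_ge0.
(* Squaring doubles the exponent to [2 ^ n.+1], so that half of the power of [P] moves to the second
   argument and leaves a diagonal value [f u u], which [fc] bounds. *)
rewrite -(ler_pXn2r (n := 2)) ?nnegrE ?(ltW k_gt0) //.
apply: (@le_of_expr2n_le _ _ _ (Num.max c 0 * r ^+ 2)) => [||n].
- exact: exprn_ge0.
- exact: exprn_gt0.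
rewrite -!exprM (mulnC 2%N) -lecR rmorphXn /= -aE.
set u := iter (2 ^ n) P x.
have le_fu : f (P x) x ^+ (2 ^ n * 2) <= f u u.
  by rewrite -expnSr (le_trans (pow n.+1)) // expnSr muln2 -addnn iterD [leLHS]Pm_sym.
apply: (le_trans le_fu); apply: (le_trans (fc u)).
(* The constant [c] may be negative; monotonicity of the product needs a nonnegative factor. *)
apply: (@le_trans _ _ (real_complex R (Num.max c 0) * `|u| ^+ 2)).
  by rewrite ler_wpM2r ?exprn_ge0 // lecR le_max lexx.
rewrite -mulrA [X in _ <= X]rmorphM ler_wpM2l ?ler0c ?le_max ?lexx ?orbT //.
rewrite mulrC exprM -exprMn rmorphXn lerXn2r ?nnegrE ?normr_ge0 //.
  by rewrite ler0c mulr_ge0 ?exprn_ge0 ?(ltW k_gt0) // -ler0c -rE normr_ge0.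
by rewrite rmorphM /= -rE Pm_le.
Qed.

Lemma modA_le (T : {linear H -> H}) : in_BA ip A T ->
  exists M : R, forall x, normA ip A x = 1 -> modA ip A T x <= M.
Proof.
move=> [T_bd [S [Ts [S_bd _ TTs AS]]]].
have [kT kT_gt0 Tk] := bounded_op_bound _ _ _ T_bd.
have [kS kS_gt0 Sk] := bounded_op_bound _ _ _ S_bd.
have fST y z : f (S (T y)) z = f (T y) (T z).
  by rewrite /ipA AS ip_conj -TTs -ip_conj.
pose P := (S \o T)%FUN : {linear H -> H}.
(* The product [kS * kT] bounds the norm of [P], hence the square of [modA ip A T x]. *)
exists (Num.sqrt (kS * kT)) => x /ipA_unit x1.
have Pk y : `|P y| <= real_complex R (kS * kT) * `|y|.
  rewrite (le_trans (Sk _)) // rmorphM -mulrA ler_wpM2l ?Tk //.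
  by rewrite ler0c ltW.
have Psym y z : f (P y) z = f y (P z).
  by rewrite fST ipA_conj -fST -ipA_conj.
have PxT : f (P x) x = f (T x) (T x) by exact: fST.
have Px_ge0 : 0 <= f (P x) x by rewrite PxT; apply: A_pos.
have := ipA_selfadjoint_le P _ x (mulr_gt0 kS_gt0 kT_gt0) Pk Psym Px_ge0 x1.
rewrite PxT => /(le_trans (normr_ipA_le (T x) x x1)) le_fT.
rewrite -[leLHS]ger0_norm ?modA_ge0 // -sqrtr_sqr ler_wsqrtr //.
by rewrite -lecR rmorphXn.
Qed.

(** As [A] is nonzero, the form is nonzero, hence positive, at some diagonal point, which is then
    normalized. *)
Lemma normA_unit_exists : (exists x, A x <> 0) -> exists x, normA ip A x = 1.
Proof.
move=> [y Ay]; have [x fx] : exists x, f x x <> 0.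
  by apply: contrapT => /forallNP fN; apply/Ay/ipA_eq0 => x; apply: contrapT.
have fx_gt0 : 0 < f x x by rewrite lt_def A_pos andbT; apply/eqP.
have /complex_realP[a aE] := gtr0_real fx_gt0.
have a_gt0 : 0 < a by rewrite aE ltcR in fx_gt0.
exists (real_complex R (Num.sqrt a)^-1 *: x).
rewrite /normA ipAZl ipAZr conj_Creal; last by apply/complex_realP; exists (Num.sqrt a)^-1.
rewrite aE -!rmorphM /= mulrA -invfM -expr2 sqr_sqrtr ?(ltW a_gt0) //.
by rewrite mulVf ?sqrtr1 // gt_eqF.
Qed.

End SemiInnerProduct.

(** This bounds one entry of the maximum; exchanging [B] and [C] gives the other. *)
Lemma wA_cA_le_wAe (R : realType) (H : completeNormedModType (complex R))
    (ip : {dot H for Num.conj}) (A : {linear H -> H}) (Hip : hilbert ip)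
    (A_bounded : bounded_op A) (A_pos : positive_op ip A)
    (A_neq0 : exists x : H, A x <> 0)
    (B C : {linear H -> H}) (B_BA : in_BA ip A B) (C_BA : in_BA ip A C) :
  wA ip A B ^+ 2 + cA ip A C ^+ 2 <= wAe ip A B C ^+ 2.
Proof.
have [MB leB] := modA_le _ _ _ _ A_pos Hip A_bounded B B_BA.
have [MC leC] := modA_le _ _ _ _ A_pos Hip A_bounded C C_BA.
have [x0 x01] := normA_unit_exists _ _ _ _ A_pos A_neq0.
have cA_ge0 : 0 <= cA ip A C.
  apply: lb_le_inf => [|_ [x _ <-]]; last exact: modA_ge0.
  by exists (modA ip A C x0), x0.
have cA_le x : normA ip A x = 1 -> cA ip A C <= modA ip A C x.
  by move=> x1; apply: ge_inf; [exists 0 => _ [y _ <-]; apply: modA_ge0 | exists x].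
have wAe_ge x : normA ip A x = 1 ->
    Num.sqrt (modA ip A B x ^+ 2 + modA ip A C x ^+ 2) <= wAe ip A B C.
  move=> x1; apply: ub_le_sup; last by exists x.
  exists (Num.sqrt (MB ^+ 2 + MC ^+ 2)) => _ [y y1 <-].
  rewrite ler_wsqrtr // lerD // lerXn2r ?nnegrE ?modA_ge0 //.
  - by apply: (le_trans _ (leB y y1)); apply: modA_ge0.
  - exact: leB.
  - by apply: (le_trans _ (leC y y1)); apply: modA_ge0.
  - exact: leC.
have wAe_ge0 : 0 <= wAe ip A B C := le_trans (sqrtr_ge0 _) (wAe_ge x0 x01).
have sqr_le x : normA ip A x = 1 ->
    modA ip A B x ^+ 2 + cA ip A C ^+ 2 <= wAe ip A B C ^+ 2.
  move=> x1; apply: (@le_trans _ _ (modA ip A B x ^+ 2 + modA ip A C x ^+ 2)).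
    by rewrite lerD2l lerXn2r ?nnegrE ?modA_ge0 ?cA_le.
  rewrite -[leLHS]sqr_sqrtr ?addr_ge0 ?sqr_ge0 //.
  by rewrite lerXn2r ?nnegrE ?sqrtr_ge0 ?wAe_ge.
have diff_ge0 : 0 <= wAe ip A B C ^+ 2 - cA ip A C ^+ 2.
  by rewrite subr_ge0 (le_trans _ (sqr_le x0 x01)) // lerDr sqr_ge0.
(* Nonnegativity of the difference allows a square root, leaving a bound on the supremum [wA ip A B]
   itself, which can be checked at each [A]-unit vector. *)
rewrite -lerBrDr -[leRHS]sqr_sqrtr // lerXn2r ?nnegrE ?sqrtr_ge0 //.
  apply: (le_trans (modA_ge0 _ _ ip A B x0)); apply: ub_le_sup; last by exists x0.
  by exists MB => _ [y y1 <-]; apply: leB.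
apply: ge_sup => [|_ [x x1 <-]]; first by exists (modA ip A B x0), x0.
rewrite -[leLHS]ger0_norm ?modA_ge0 // -sqrtr_sqr ler_wsqrtr // lerBrDr.
exact: sqr_le.
Qed.

Theorem theorem2p19 (R : realType) (H : completeNormedModType (complex R))
    (ip : {dot H for Num.conj}) (Hip : hilbert ip)
    (A : {linear H -> H}) (A_bounded : bounded_op A)
    (A_pos : positive_op ip A) (A_neq0 : exists x : H, A x <> 0)
    (B C : {linear H -> H}) (B_BA : in_BA ip A B) (C_BA : in_BA ip A C) :
  Num.max (wA ip A B ^+ 2 + cA ip A C ^+ 2) (wA ip A C ^+ 2 + cA ip A B ^+ 2)
    <= wAe ip A B C ^+ 2.
Proof.
have wAeC : wAe ip A B C = wAe ip A C B.
  by congr (sup _); apply: eq_imagel => x _; rewrite addrC.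
by rewrite ge_max {2}wAeC !wA_cA_le_wAe.
Qed.
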